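(* Given an SB representation of an $n$-vertex graph $G=(V,E)$ based on a biclique partition $\mathcal B$, an independent set query $S\subseteq V$ can be answered in time $O(w(\mathcal B)+|S|)$.
   Context: All graphs are finite, simple and undirected. A biclique of a graph $G$ is a (not necessarily induced) complete bipartite subgraph $(L,R)$ of $G$ with sides $L,R$. A biclique partition of $G$ is a family $\mathcal B=\{(L_1,R_1),\dots,(L_k,R_k)\}$ of bicliques of $G$ whose edge sets partition $E(G)$; its weight is $w(\mathcal B)=\sum_{i=1}^k(|L_i|+|R_i|)$. The SB (succinct biclique) representation of $G$ based on $\mathcal B$ is a list of the bicliques in $\mathcal B$, where each biclique is stored as two sorted lists of vertices corresponding to its two sides (with their lengths). An independent set query with input $S\subseteq V$ asks whether $S$ is an independent set of $G$. Running times are in the standard word-RAM model with words of $\Theta(\log n)$ bits. *)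

(* Defs.v *)
From mathcomp Require Import all_boot.

Set Implicit Arguments.
Unset Strict Implicit.
Unset Printing Implicit Defensive.

(** ** Graphs and biclique partitions

    A graph on the vertex set [0, ..., n-1] is a symmetric irreflexive
    [e : rel 'I_n]; its edges are the two-element sets [{u, v}]. *)

Section Bicliques.
Variable n : nat.
Implicit Types (e : rel 'I_n) (p : {set 'I_n} * {set 'I_n})
  (B : seq ({set 'I_n} * {set 'I_n})) (S : {set 'I_n}).

Definition graph_edges e : {set {set 'I_n}} :=
  [set [set uv.1; uv.2] | uv : 'I_n * 'I_n & e uv.1 uv.2].

Definition biclique e p : bool :=
  [disjoint p.1 & p.2] && [forall u in p.1, forall v in p.2, e u v].

Definition biclique_edges p : {set {set 'I_n}} :=
  [set [set u; v] | u in p.1, v in p.2].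

(** [partition] forbids empty blocks, so both sides of every biclique of the
    family are nonempty. The [uniq] condition is needed because [B] is an
    indexed family, whereas [partition] only sees the set of its blocks. *)
Definition biclique_partition e B : bool :=
  [&& all (biclique e) B,
      uniq [seq biclique_edges p | p <- B] &
      partition [set:: [seq biclique_edges p | p <- B]] (graph_edges e)].

Definition weight B : nat := \sum_(p <- B) (#|p.1| + #|p.2|).

Definition independent e S : bool :=
  [forall u in S, forall v in S, ~~ e u v].

(** ** Representations as sequences of words *)

Definition list_words (s : seq 'I_n) : seq nat :=
  size s :: [seq val v | v <- s].

(** [enum A] lists the elements of [A : {set 'I_n}] in increasing order. *)
Definition SB_words B : seq nat :=
  size B :: flatten [seq list_words (enum p.1) ++ list_words (enum p.2) | p <- B].

End Bicliques.

(** ** Word RAM with [w]-bit words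

    Registers and memory cells hold numbers below [2 ^ w], and a memory address
    is a word. A program is a finite list of instructions, hence uses finitely
    many registers; every instruction takes unit time. *)

Inductive binop :=
  | OpAdd | OpSub | OpMul | OpDiv | OpMod
  | OpAnd | OpOr | OpXor | OpShl | OpShr
  | OpEq | OpLt.

Inductive instr :=
  | Const (r k : nat)             (* r <- k *)
  | Bin (o : binop) (r x y : nat) (* r <- x o y *)
  | Read (r x : nat)              (* r <- mem[x] *)
  | Write (x y : nat)             (* mem[x] <- y *)
  | Jump (l : nat)
  | JumpZ (x l : nat)             (* jump to l if x = 0 *)
  | Halt.

Definition program := seq instr.

Record config := Config { pc : nat; reg : nat -> nat; mem : nat -> nat }.

(** Division and remainder follow the library's convention for divisor 0. *)
Definition binop_eval (w : nat) (o : binop) (x y : nat) : nat :=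
  match o with
  | OpAdd => x + y
  | OpSub => x + (2 ^ w - y)
  | OpMul => x * y
  | OpDiv => x %/ y
  | OpMod => x %% y
  | OpAnd => Nat.land x y
  | OpOr => Nat.lor x y
  | OpXor => Nat.lxor x y
  | OpShl => x * 2 ^ y
  | OpShr => x %/ 2 ^ y
  | OpEq => x == y
  | OpLt => x < y
  end %% 2 ^ w.

(** Running off the end of the program halts. *)
Definition current (P : program) (c : config) : instr := nth Halt P (pc c).

Definition halted (P : program) (c : config) : Prop := current P c = Halt.

Definition step (w : nat) (P : program) (c : config) : config :=
  let: Config i r m := c in
  match current P c with
  | Const d k => Config i.+1 [eta r with d |-> k %% 2 ^ w] m
  | Bin o d x y => Config i.+1 [eta r with d |-> binop_eval w o (r x) (r y)] m
  | Read d x => Config i.+1 [eta r with d |-> m (r x)] m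
  | Write x y => Config i.+1 r [eta m with r x |-> r y]
  | Jump l => Config l r m
  | JumpZ x l => Config (if r x == 0 then l else i.+1) r m
  | Halt => c
  end.

(** The input occupies the memory cells from address 0 on; the contents of all
    other cells are arbitrary words. *)
Definition holds_input (w : nat) (input : seq nat) (m : nat -> nat) : Prop :=
  (forall i, m i < 2 ^ w) /\ (forall i, i < size input -> m i = nth 0 input i).

Definition initial (m : nat -> nat) : config := Config 0 (fun=> 0) m.

(** The answer is read off register 0. *)
Definition answers_within (w : nat) (P : program) (m : nat -> nat)
    (t : nat) (ans : nat) : Prop :=
  exists2 t', t' <= t &
    let c := iter t' (step w P) (initial m) in halted P c /\ reg c 0 = ans.

(** Number of bits of [n], i.e. floor (log2 n) + 1, so that it is positive for
    every [n]. *)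
Definition bits (n : nat) : nat := (trunc_log 2 n).+1.

(* Main.v *)
Require Import Defs.
From mathcomp Require Import all_boot zify.

Set Implicit Arguments.
Unset Strict Implicit.
Unset Printing Implicit Defensive.

(** Every edge lies in some biclique [(L, R)], and every vertex of [L] is
    adjacent to every vertex of [R]; hence [S] is independent iff no biclique
    has both sides meeting [S] ([independent_bicliques]). Given a constant-time
    membership test for [S], one scan of the lists of the representation decides
    this.

    The membership test is the delicate point: the memory outside the input
    holds arbitrary words, and clearing a table of [n] cells could cost more
    than [weight B + #|S|]. The table is therefore left uncleared: the cell
    of index [v] of a table placed just after the input receives the address at
    which [v] occurs in the list of [S]. A vertex [v] is declared a member iff
    its cell holds an address inside that list and the word at that address
    is [v]. An arbitrary word passes this test only if [v] does occur in the
    list, so the test is correct although only [#|S|] cells were written.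

    The program [prog] makes three passes: it skips over the bicliques to find
    the list of [S] ([skip_loop]), fills the table ([fill_loop]), and scans
    the sides of the bicliques ([visit_pairs], by way of [scan_loop] for one
    list). Each pass is linear in the lengths it traverses. The headers of the
    lists add two words per biclique, which the weight pays for, as sides are
    nonempty ([size_leq_weight]).

    Addresses must fit into a word. A partition of the edges into nonempty
    blocks has at most [n ^ 2] blocks, so the input and the table occupy
    [O(n ^ 3)] cells, and words of [6 * bits n] bits suffice ([input_fits]). *)

(** * The program *)

(** Registers. [ptr] runs through the input, [qry] is the address of the word
    holding the length of the list of [S], and [tab] is the address following
    the input, where the table starts; the list of [S] thus occupies the
    addresses strictly between [qry] and [tab]. During the last pass [side] is
    1 on left sides and 0 on right sides, [hit] tells whether the current list
    meets [S], [lhit] whether the preceding left side did, and [acc] whether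
    some biclique had both sides meeting [S]. Register [zero] is never written
    and keeps its initial value. *)
Local Notation acc := 0 (only parsing).
Local Notation one := 1 (only parsing).
Local Notation ptr := 2 (only parsing).
Local Notation num := 3 (only parsing).
Local Notation qry := 4 (only parsing).
Local Notation tab := 5 (only parsing).
Local Notation lim := 6 (only parsing).
Local Notation vtx := 7 (only parsing).
Local Notation idx := 8 (only parsing).
Local Notation hit := 9 (only parsing).
Local Notation lhit := 10 (only parsing).
Local Notation side := 11 (only parsing).
Local Notation zero := 12 (only parsing).
Local Notation tmp := 13 (only parsing).
Local Notation tmp' := 14 (only parsing).
Local Notation cnt := 15 (only parsing).

Definition prog : program :=
  [:: (* 0: read the number of bicliques *)
      Const one 1
    ; Const side 1
    ; Const ptr 1
    ; Read num zero
    (* 4: skip the two lists of each biclique *)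
    ; Bin OpLt tmp cnt num
    ; JumpZ tmp 14
    ; Read vtx ptr
    ; Bin OpAdd ptr ptr vtx
    ; Bin OpAdd ptr ptr one
    ; Read vtx ptr
    ; Bin OpAdd ptr ptr vtx
    ; Bin OpAdd ptr ptr one
    ; Bin OpAdd cnt cnt one
    ; Jump 4
    (* 14: [ptr] has reached the list of [S] *)
    ; Bin OpAdd qry ptr zero
    ; Read tab qry
    ; Bin OpAdd ptr qry one
    ; Bin OpAdd tab tab ptr
    (* 18: enter each element of [S] in the table *)
    ; Bin OpLt tmp ptr tab
    ; JumpZ tmp 25
    ; Read vtx ptr
    ; Bin OpAdd idx vtx tab
    ; Write idx ptr
    ; Bin OpAdd ptr ptr one
    ; Jump 18
    (* 25: back to the first biclique *)
    ; Const ptr 1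
    (* 26: next list; all are done when [ptr = qry] *)
    ; Bin OpLt tmp ptr qry
    ; JumpZ tmp 51
    ; Const hit 0
    ; Read lim ptr
    ; Bin OpAdd ptr ptr one
    ; Bin OpAdd lim lim ptr
    (* 32: update [hit] with the membership test of the next vertex *)
    ; Bin OpLt tmp ptr lim
    ; JumpZ tmp 46
    ; Read vtx ptr
    ; Bin OpAdd idx vtx tab
    ; Read idx idx
    ; Bin OpLt tmp qry idx
    ; Bin OpLt tmp' idx tab
    ; Bin OpMul tmp tmp tmp'
    ; Read tmp' idx
    ; Bin OpEq tmp' tmp' vtx
    ; Bin OpMul tmp tmp tmp'
    ; Bin OpOr hit hit tmp
    ; Bin OpAdd ptr ptr one
    ; Jump 32
    (* 46: end of a list *)
    ; Bin OpMul tmp lhit hit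
    ; Bin OpOr acc acc tmp
    ; Bin OpMul lhit hit side
    ; Bin OpEq side side zero
    ; Jump 26
    (* 51: negate [acc], the answer register *)
    ; Bin OpEq acc acc zero
    ; Halt ].

(** * Lists in memory *)

Definition stored (m : nat -> nat) (p : nat) (l : seq nat) :=
  forall i, i < size l -> m (p + i) = nth 0 l i.

Lemma stored_cons m p x l :
  stored m p (x :: l) <-> m p = x /\ stored m p.+1 l.
Proof.
split=> [ml | [mp ml] [|i] lt_i]; last by rewrite addnS -addSn ml.
  by split=> [|i lt_i]; [rewrite -[p]addn0 ml | rewrite addSn -addnS ml].
by rewrite addn0.
Qed.

Lemma stored_cat m p l1 l2 :
  stored m p (l1 ++ l2) <-> stored m p l1 /\ stored m (p + size l1) l2.
Proof.
elim: l1 p => [|x l1 IH] p /=; first by rewrite addn0; split=> [|[]].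
by rewrite !stored_cons IH addSnnS; tauto.
Qed.

(** The memory image of a list: its length, then its elements. *)
Definition framed (l : seq nat) := size l :: l.

Definition framed_pairs (ps : seq (seq nat * seq nat)) :=
  flatten [seq framed p.1 ++ framed p.2 | p <- ps].

Lemma framed_pairs_cons L R ps :
  framed_pairs ((L, R) :: ps) = framed L ++ framed R ++ framed_pairs ps.
Proof. by rewrite catA. Qed.

(** * Timed reachability *)

Definition reaches w c t (Q : config -> Prop) :=
  exists2 k, k <= t & Q (iter k (step w prog) c).

Lemma reaches_now w c t (Q : config -> Prop) : Q c -> reaches w c t Q.
Proof. by exists 0. Qed.

Lemma reaches_step w c t Q :
  reaches w (step w prog c) t Q -> reaches w c t.+1 Q.
Proof. by case=> k le_kt Qk; exists k.+1; rewrite ?iterSr. Qed.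

Lemma reaches_seq w c t1 t2 Q1 Q2 :
    reaches w c t1 Q1 -> (forall c', Q1 c' -> reaches w c' t2 Q2) ->
  reaches w c (t1 + t2) Q2.
Proof.
case=> k1 le1 Qk1 /(_ _ Qk1)[k2 le2 Qk2].
by exists (k2 + k1); rewrite ?iterD // addnC leq_add.
Qed.

Lemma reaches_weaken w c t1 t2 (Q1 Q2 : config -> Prop) :
    t1 <= t2 -> (forall c', Q1 c' -> Q2 c') ->
  reaches w c t1 Q1 -> reaches w c t2 Q2.
Proof.
move=> le12 Q12 [k le_k Qk]; exists k; last exact: Q12.
exact: leq_trans le_k le12.
Qed.

Section Word.
Variable w : nat.
Hypothesis w_gt0 : 0 < w.

Lemma ltn1_word : 1 < 2 ^ w.
Proof. by rewrite -[1]/(2 ^ 0) ltn_exp2l. Qed.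

Lemma modn_bool (b : bool) : b %% 2 ^ w = b.
Proof. by rewrite modn_small //; case: b; have := ltn1_word; lia. Qed.

Lemma evalD x y : x + y < 2 ^ w -> binop_eval w OpAdd x y = x + y.
Proof. exact: modn_small. Qed.

Lemma evalLt x y : binop_eval w OpLt x y = (x < y).
Proof. exact: modn_bool. Qed.

Lemma evalEq x y : binop_eval w OpEq x y = (x == y).
Proof. exact: modn_bool. Qed.

Lemma evalMb (a b : bool) : binop_eval w OpMul a b = (a && b).
Proof. by rewrite /binop_eval mulnb modn_bool. Qed.

Lemma evalOrb (a b : bool) : binop_eval w OpOr a b = (a || b).
Proof. by rewrite -[RHS]modn_bool; case: a b => [] []. Qed.


(** One rule per instruction, for running the program symbolically. The value
    [v] given to the destination register is supplied in simplified form, so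
    that register contents do not grow along a run. *)
Section Instructions.
Implicit Types (r m : nat -> nat) (Q : config -> Prop).

Lemma reaches_const r m t Q i d k :
    nth Halt prog i = Const d k -> k < 2 ^ w ->
    reaches w (Config i.+1 [eta r with d |-> k] m) t Q ->
  reaches w (Config i r m) t.+1 Q.
Proof.
move=> Pi lt_k h; apply: reaches_step.
by rewrite /step /current Pi modn_small.
Qed.

Lemma reaches_bin r m t Q i o d x y v :
    nth Halt prog i = Bin o d x y -> binop_eval w o (r x) (r y) = v ->
    reaches w (Config i.+1 [eta r with d |-> v] m) t Q ->
  reaches w (Config i r m) t.+1 Q.
Proof.
by move=> Pi <- h; apply: reaches_step; rewrite /step /current Pi.
Qed.

Lemma reaches_add r m t Q i d x y v :
    nth Halt prog i = Bin OpAdd d x y -> r x + r y = v -> v < 2 ^ w ->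
    reaches w (Config i.+1 [eta r with d |-> v] m) t Q ->
  reaches w (Config i r m) t.+1 Q.
Proof. by move=> Pi <- ?; apply: (reaches_bin Pi); rewrite evalD. Qed.

Lemma reaches_read r m t Q i d x a v :
    nth Halt prog i = Read d x -> r x = a -> m a = v ->
    reaches w (Config i.+1 [eta r with d |-> v] m) t Q ->
  reaches w (Config i r m) t.+1 Q.
Proof.
by move=> Pi <- <- h; apply: reaches_step; rewrite /step /current Pi.
Qed.

Lemma reaches_write r m t Q i x y a v :
    nth Halt prog i = Write x y -> r x = a -> r y = v ->
    reaches w (Config i.+1 r [eta m with a |-> v]) t Q ->
  reaches w (Config i r m) t.+1 Q.
Proof.
by move=> Pi <- <- h; apply: reaches_step; rewrite /step /current Pi.
Qed.

Lemma reaches_jump r m t Q i l :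
    nth Halt prog i = Jump l -> reaches w (Config l r m) t Q ->
  reaches w (Config i r m) t.+1 Q.
Proof. by move=> Pi h; apply: reaches_step; rewrite /step /current Pi. Qed.

(** The two-instruction test at the head of each loop. *)
Lemma reaches_test r m t Q i d x y l (b : bool) :
    nth Halt prog i = Bin OpLt d x y -> nth Halt prog i.+1 = JumpZ d l ->
    (r x < r y) = b ->
    reaches w (Config (if b then i.+2 else l) [eta r with d |-> b : nat] m) t Q ->
  reaches w (Config i r m) t.+2 Q.
Proof.
move=> Pi Pi1 <- h; apply: (reaches_bin Pi (evalLt _ _)).
apply: reaches_step; rewrite /step /current Pi1 /= eqxx eqb0.
by case: (r x < r y) h.
Qed.

End Instructions.

(** The loops are specified by the registers they may overwrite; everything kept
    in other registers survives them. *)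
Definition unchanged (xs : seq nat) (r r' : nat -> nat) :=
  forall x, x \notin xs -> r' x = r x.

Lemma unchanged_refl xs r : unchanged xs r r.
Proof. by []. Qed.

Lemma unchanged_setr xs r r' d v : d \in xs ->
  unchanged xs r r' -> unchanged xs r [eta r' with d |-> v].
Proof.
move=> d_xs fr x; case: (eqVneq x d) => [->|/negPf xd] /=; rewrite ?d_xs ?xd //.
exact: fr.
Qed.

Lemma unchanged_setl xs r r' d v : d \in xs ->
  unchanged xs [eta r with d |-> v] r' -> unchanged xs r r'.
Proof.
move=> d_xs fr x x_xs; rewrite fr //=.
by case: eqP x_xs => // ->; rewrite d_xs.
Qed.

Lemma unchanged_sub xs ys r r' :
  unchanged xs r r' -> all (mem ys) xs -> unchanged ys r r'.
Proof. by move=> fr /allP sub x /(contra (sub x)); exact: fr. Qed.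

(** Each tactic runs the instruction at the current program counter; the
    arguments are the values it tests, computes or reads. *)
Ltac test b := eapply (@reaches_test _ _ _ _ _ _ _ _ _ b);
  [reflexivity | reflexivity | rewrite /=; lia | rewrite /=].
Ltac add v := eapply (@reaches_add _ _ _ _ _ _ _ _ v);
  [reflexivity | rewrite /=; lia | lia | rewrite /=].
Ltac read a v := eapply (@reaches_read _ _ _ _ _ _ _ a v);
  [reflexivity | rewrite /=; lia | try done | rewrite /=].
Ltac jump := eapply reaches_jump; [reflexivity | rewrite /=].
Ltac bin v := eapply (@reaches_bin _ _ _ _ _ _ _ _ _ v);
  [reflexivity | rewrite /= | rewrite /=].
(** Proves an [unchanged] goal from [fr], discarding the register updates made
    before and after the part of the run that [fr] describes. *)
Ltac framing fr := do ?(apply: unchanged_setr; first by []);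
  let fr' := fresh "fr" in
  match goal with |- unchanged ?ys _ _ =>
    have fr' := @unchanged_sub _ ys _ _ fr isT end;
  do ?(apply unchanged_setl in fr'; last by []); exact fr'.

(** * The three passes *)

Lemma skip_loop m ps p r i :
    r one = 1 -> r ptr = p -> r cnt = i -> r num = i + size ps ->
    stored m p (framed_pairs ps) ->
    p + size (framed_pairs ps) < 2 ^ w -> i + size ps < 2 ^ w ->
  reaches w (Config 4 r m) (10 * size ps + 2) (fun c => exists r',
    [/\ c = Config 14 r' m, unchanged [:: ptr; vtx; tmp; cnt] r r'
      & r' ptr = p + size (framed_pairs ps)]).
Proof.
elim: ps p r i => [|[L R] ps IH] p r i r1 rp rc rn mp pw iw.
  rewrite addn0 in rn; test false; apply: reaches_now; eexists; split=> //.
    by framing (@unchanged_refl [::] r).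
  by rewrite addn0.
move: mp pw iw rn; rewrite framed_pairs_cons !stored_cat !stored_cons.
rewrite !size_cat /= => -[[mL _] [[mR _] mp]] pw iw rn.
rewrite mulnS -addnA.
test true.
read p (size L).
add (p + size L).
add (p + (size L).+1).
read (p + (size L).+1) (size R).
add (p + (size L).+1 + size R).
add (p + (size L).+1 + (size R).+1).
add i.+1.
jump.
apply: reaches_weaken
  (IH (p + (size L).+1 + (size R).+1) _ i.+1 _ _ _ _ _ _ _) => //=; try lia.
move=> c [r' [-> fr rp']]; exists r'; split=> //; last by rewrite rp'; lia.
by framing fr.
Qed.

(** If a vertex occurs several times in [s], its cell ends up with the address
    of the last occurrence, which serves as well as any other. The last clause
    makes the induction work: the cell of the head survives the rest of the loop
    if the head does not occur in the tail. *)
Lemma fill_loop m s p T n r :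
    r one = 1 -> r ptr = p -> r tab = T -> p + size s = T ->
    stored m p s -> all (ltn^~ n) s -> T + n < 2 ^ w ->
  reaches w (Config 18 r m) (7 * size s + 2) (fun c => exists r' m',
    [/\ c = Config 25 r' m', unchanged [:: ptr; vtx; idx; tmp] r r',
        forall a, a < T -> m' a = m a,
        forall v, v \in s -> p <= m' (T + v) < T /\ m (m' (T + v)) = v
      & forall v, v \notin s -> m' (T + v) = m (T + v)]).
Proof.
move=> + + + + + + Tn.
elim: s p r m => [|v s IH] p r m r1 rp rT pT.
  rewrite addn0 in pT => _ _; test false; apply: reaches_now.
  exists [eta r with tmp |-> 0], m; split=> //; by framing (@unchanged_refl [::] r).
rewrite stored_cons => -[mv ms] /= /andP[vn sn]; rewrite /= in pT.
rewrite mulnS -addnA.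
test true.
read p v.
add (T + v).
eapply (@reaches_write _ _ _ _ _ _ _ (T + v) p); [reflexivity| by []| by []|].
add p.+1.
jump.
apply: reaches_weaken (IH p.+1 _ [eta m with T + v |-> p] _ _ _ _ _ _) => //=; try lia.
  move=> c [r' [m' [-> fr lo ins out]]]; exists r', m'; split=> //.
  - by framing fr.
  - move=> a aT; rewrite lo //=; case: eqP => // ?; lia.
  - move=> u; rewrite inE; case: (boolP (u \in s)) => [us _|us].
      case: (ins _ us) => b; case: eqP => [|_ eu]; lia.
    by rewrite orbF => /eqP uv; subst u; rewrite out //= eqxx; lia.
  move=> u; rewrite inE negb_or => /andP[uv us].
  rewrite out //=; case: eqP => // ?; lia.
move=> i lti; rewrite -ms //=; case: eqP => // ?; lia.
Qed.

(** The last pass relies on the memory only through [tableP]: the test performed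
    by the program is membership in [s]. *)
Section Query.
Variables (n A T : nat) (s : seq nat) (m : nat -> nat).
Hypotheses (AT : A < T) (Tn : T + n < 2 ^ w).
Hypothesis tableP : forall v, v < n ->
  (A < m (T + v) < T) && (m (m (T + v)) == v) = (v \in s).

Definition meets (l : seq nat) := has (mem s) l.

Lemma scan_loop l p r (h : bool) :
    r one = 1 -> r tab = T -> r qry = A -> r ptr = p -> r lim = p + size l ->
    r hit = h -> stored m p l -> all (ltn^~ n) l -> p + size l < 2 ^ w ->
  reaches w (Config 32 r m) (14 * size l + 2) (fun c => exists r',
    [/\ c = Config 46 r' m,
        unchanged [:: ptr; vtx; idx; hit; tmp; tmp'] r r',
        r' ptr = p + size l & r' hit = h || meets l]).
Proof.
elim: l p r h => [|v l IH] p r h r1 rT rA rp rl rh.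
  rewrite addn0 in rl => _ _ _; test false; apply: reaches_now; eexists.
  split=> //=; first (by framing (@unchanged_refl [::] r)); first by rewrite addn0.
  by rewrite orbF.
rewrite stored_cons => -[mv ml] /= /andP[vn ln] pw; rewrite /= in rl.
rewrite mulnS -addnA.
test true.
read p v.
add (T + v).
read (T + v) (m (T + v)).
bin (A < m (T + v) : nat); first by rewrite evalLt rA.
bin (m (T + v) < T : nat); first by rewrite evalLt rT.
bin (A < m (T + v) < T : nat); first by rewrite evalMb.
read (m (T + v)) (m (m (T + v))).
bin (m (m (T + v)) == v : nat); first by rewrite evalEq.
bin (v \in s : nat); first by rewrite evalMb tableP.
bin (h || (v \in s) : nat); first by rewrite rh evalOrb.
add p.+1.
jump.
apply: reaches_weaken (IH p.+1 _ (h || (v \in s)) _ _ _ _ _ _ _ _ _) => //=; try lia.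
move=> c [r' [-> fr rp' rh']]; exists r'; split=> //.
- by framing fr.
- by rewrite rp'; lia.
by rewrite rh' orbA.
Qed.

Definition constants r := [/\ r one = 1, r zero = 0, r tab = T & r qry = A].

(** The update of [lhit] multiplies by [side], so that after a right side [lhit]
    is 0 and the next left side adds nothing to [acc]; thereby left and right
    sides are treated by the same code. *)
Lemma visit_list l p r (a h q : bool) :
    constants r -> r ptr = p -> r acc = a -> r lhit = h -> r side = q ->
    stored m p (framed l) -> all (ltn^~ n) l -> p + size l < A ->
  reaches w (Config 26 r m) (14 * size (framed l)) (fun c =>
    exists2 r', c = Config 26 r' m &
    [/\ constants r', r' ptr = p + size (framed l),
        r' acc = a || h && meets l, r' lhit = meets l && q & r' side = ~~ q]).
Proof.
move=> [r1 r0 rT rA] rp ra rh rq; rewrite stored_cons => -[mp ml] ln pA.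
have -> : 14 * size (framed l) = 6 + ((14 * size l + 2) + 6).
  rewrite /=; lia.
test true.
eapply reaches_const; [reflexivity|lia|].
read p (size l).
add p.+1.
add (p.+1 + size l).
apply: reaches_seq (@scan_loop l p.+1 _ false _ _ _ _ _ _ _ _ _) _ => //=; try lia.
move=> c [r' [-> fr rp' rh']].
bin (h && meets l : nat); first by rewrite fr //= rh rh' evalMb.
bin (a || h && meets l : nat); first by rewrite fr //= ra evalOrb.
bin (meets l && q : nat); first by rewrite rh' fr //= rq evalMb.
bin (~~ q : nat); first by rewrite !fr //= r0 rq evalEq; case: (q).
jump.
apply: reaches_now; eexists; first reflexivity.
by split=> //=; [split; rewrite /= fr | rewrite rp' addSnnS].
Qed.

Lemma visit_pairs ps p r (a : bool) :
    constants r -> r ptr = p -> r acc = a -> r lhit = 0 -> r side = 1 ->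
    stored m p (framed_pairs ps) ->
    all (fun lr => all (ltn^~ n) lr.1 && all (ltn^~ n) lr.2) ps ->
    p + size (framed_pairs ps) = A ->
  reaches w (Config 26 r m) (14 * size (framed_pairs ps) + 4) (fun c =>
    halted prog c /\
    reg c 0 = ~~ (a || has (fun lr => meets lr.1 && meets lr.2) ps)).
Proof.
elim: ps p r a => [|[L R] ps IH] p r a rc rp ra rh rq.
  case: rc => r1 r0 rT rA; rewrite addn0 => _ _ pA; test false.
  bin (~~ a : nat); first by rewrite ra r0 evalEq; case: (a).
  by apply: reaches_now; rewrite /= orbF.
rewrite framed_pairs_cons !stored_cat !size_cat => -[mL [mR mp]] nps pA.
have /= /andP[/andP[Ln Rn] psn] := nps.
have [pL pR] : p + size L < A /\ p + size (framed L) + size R < A.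
  by rewrite -pA /=; lia.
rewrite 2!mulnDr -2!addnA.
apply: reaches_seq (@visit_list L p r a false true _ _ _ _ _ _ _ _) _ => //.
move=> _ [r' -> [rc' rp' ra' rh' rq']].
rewrite andbT orbF in ra' rh'.
apply: reaches_seq (@visit_list R _ r' a (meets L) false _ rp' _ _ _ _ _ _) _ => //.
move=> _ [r2 -> [rc2 rp2 ra2 rh2 rq2]].
rewrite andbF in rh2.
apply: reaches_weaken (IH _ r2 _ rc2 rp2 ra2 rh2 rq2 mp psn _) => //.
  by move=> c [hc ->]; rewrite /= orbA.
by rewrite -pA !addnA.
Qed.

End Query.

(** The space required in the fourth hypothesis is that of the input, with its
    two leading lengths, followed by the table of [n] cells. *)
Lemma prog_correct m ps s n :
    stored m 0 (size ps :: framed_pairs ps ++ framed s) ->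
    all (fun lr => all (ltn^~ n) lr.1 && all (ltn^~ n) lr.2) ps ->
    all (ltn^~ n) s ->
    size (framed_pairs ps) + size s + n + 2 < 2 ^ w -> size ps < 2 ^ w ->
  reaches w (initial m)
    (10 * size ps + 7 * size s + 14 * size (framed_pairs ps) + 18) (fun c =>
    halted prog c /\
    reg c 0 = ~~ has (fun lr => meets s lr.1 && meets s lr.2) ps).
Proof.
move=> + nps ns fit fit_ps.
rewrite stored_cons stored_cat stored_cons => -[m0 [mps [mA ms]]].
set A := 1 + size (framed_pairs ps) in mA ms.
set T := A.+1 + size s.
have Tw : T + n < 2 ^ w by rewrite /T /A; lia.
have -> : 10 * size ps + 7 * size s + 14 * size (framed_pairs ps) + 18 =
  4 + ((10 * size ps + 2) + (4 + ((7 * size s + 2) +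
    (1 + (14 * size (framed_pairs ps) + 5))))) by lia.
have w1 := ltn1_word.
rewrite /initial.
do 3!(eapply reaches_const; [reflexivity|lia|]).
read 0 (size ps).
apply: reaches_seq (@skip_loop m ps 1 _ 0 _ _ _ _ _ _ _) _ => //=; first lia.
move=> _ [r [-> fr rp]].
have [r1 r0] : r one = 1 /\ r zero = 0 by rewrite !fr.
have [ra [rh rq]] : r acc = 0 /\ r lhit = 0 /\ r side = 1 by rewrite !fr.
add A.
read A (size s).
add A.+1.
add T.
apply: reaches_seq (@fill_loop m s A.+1 T n _ _ _ _ _ _ _ _) _ => //.
move=> _ [r' [m' [-> fr' lo ins out]]].
eapply reaches_const; [reflexivity|lia|].
have mps' : stored m' 1 (framed_pairs ps).
  by move=> i lti; rewrite lo ?mps // /T /A; lia.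
(* For [v] outside [s] the table cell is arbitrary; if it points into the list
   of [s], the word found there is an element of [s], hence differs from [v]. *)
have tableP v : v < n ->
    (A < m' (T + v) < T) && (m' (m' (T + v)) == v) = (v \in s).
  move=> vn; case: (boolP (v \in s)) => vs.
    have [/andP[Ax xT] mx] := ins v vs.
    by rewrite (lo _ xT) mx eqxx Ax xT.
  apply/negP => /andP[/andP[Ax xT] /eqP mx]; case/negP: vs.
  rewrite -mx (lo _ xT) -(subnKC Ax) ms ?mem_nth //;
    by rewrite ltn_subLR.
apply: reaches_weaken
  (@visit_pairs n A T s m' _ _ tableP ps 1 _ false _ _ _ _ _ mps' nps _);
  rewrite //= ?fr' //=; try lia.
by split; rewrite /= fr'.
Qed.

End Word.

(** * Biclique partitions *)

Section Graph.
Variables (n : nat) (e : rel 'I_n) (B : seq ({set 'I_n} * {set 'I_n})).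
Hypothesis partB : biclique_partition e B.

(** An edge inside [S] lies in a block of the partition, whose biclique then has
    an end of that edge on each side; conversely a vertex of [S] on each side of
    a biclique gives an edge inside [S]. *)
Lemma independent_bicliques (S : {set 'I_n}) :
  independent e S =
  ~~ has (fun p => (p.1 :&: S != set0) && (p.2 :&: S != set0)) B.
Proof.
case/and3P: partB => /allP bicB _ /and3P[/eqP coverB _ _].
apply/idP/hasPn => [indS p pB | noB].
  apply/negP => /andP[/set0Pn[u /setIP[u1 uS]] /set0Pn[v /setIP[v2 vS]]].
  have /andP[_ /forall_inP /(_ u u1) /forall_inP /(_ v v2) euv] := bicB p pB.
  by have /forall_inP /(_ u uS) /forall_inP /(_ v vS) := indS; rewrite euv.
apply/forall_inP => u uS; apply/forall_inP => v vS; apply/negP => euv.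
have: [set u; v] \in graph_edges e.
  by apply/imsetP; exists (u, v); rewrite ?inE.
rewrite -coverB => /bigcupP[E]; rewrite inE => /mapP[p pB ->].
case/imset2P => x y x1 y2 uvE; case/negP: (noB p pB).
have sub z : z \in [set x; y] -> z \in S by rewrite -uvE => /set2P[]->.
apply/andP; split; apply/set0Pn.
  by exists x; rewrite inE x1 sub // set21.
by exists y; rewrite inE y2 sub // set22.
Qed.

(** The blocks are nonempty, disjoint and pairwise distinct as an indexed
    family, so there are at most as many as edges. *)
Lemma size_biclique_partition : size B <= n * n.
Proof.
case/and3P: partB => _ uniqB partE.
have cardE := card_partition partE; case/and3P: partE => _ _ no0.
have le_edges : #|graph_edges e| <= n * n.
  rewrite -[in leqRHS](card_ord n) -card_prod.
  exact: leq_trans (leq_imset_card _ _) (max_card _).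
apply: leq_trans le_edges; rewrite cardE.
rewrite -(size_map (@biclique_edges n)) -(card_uniqP uniqB) -cardsE -sum1_card.
apply: leq_sum => E EB; rewrite card_gt0.
by apply: contraNneq no0 => <-.
Qed.

(** An empty side would give an empty block. *)
Lemma biclique_left_nonempty p : p \in B -> 0 < #|p.1|.
Proof.
case/and3P: partB => _ _ /and3P[_ _ no0] pB.
rewrite card_gt0; apply: contraNneq no0 => p10.
rewrite inE; apply/mapP; exists p => //.
apply/esym/setP => E; rewrite !inE; apply/imset2P => -[x y].
by rewrite p10 inE.
Qed.

Lemma size_leq_weight : size B <= weight B.
Proof.
rewrite /weight -sum1_size big_seq [leqRHS]big_seq.
by apply: leq_sum => p /biclique_left_nonempty p1; rewrite addn_gt0 p1.
Qed.

Lemma weight_leq : weight B <= 2 * n * size B.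
Proof.
rewrite -sum1_size big_distrr; apply: leq_sum => p _ /=.
rewrite muln1 mul2n -addnn.
by apply: leq_add; rewrite -[leqRHS]card_ord max_card.
Qed.

End Graph.

(** * The input of the program *)

Section Words.
Variable n : nat.
Implicit Types (A S : {set 'I_n}) (B : seq ({set 'I_n} * {set 'I_n})).

Definition vals (s : seq 'I_n) : seq nat := [seq val v | v <- s].

Lemma size_vals A : size (vals (enum A)) = #|A|.
Proof. by rewrite size_map cardE. Qed.

Definition sides B : seq (seq nat * seq nat) :=
  [seq (vals (enum p.1), vals (enum p.2)) | p : {set 'I_n} * {set 'I_n} <- B].

Lemma all_vals s : all (ltn^~ n) (vals s).
Proof. by apply/allP => _ /mapP[v _ ->]; exact: ltn_ord. Qed.

Lemma all_sides B :
  all (fun lr => all (ltn^~ n) lr.1 && all (ltn^~ n) lr.2) (sides B).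
Proof. by apply/allP => _ /mapP[p _ ->]; rewrite !all_vals. Qed.

Lemma input_words B s :
  SB_words B ++ list_words s =
    size (sides B) :: framed_pairs (sides B) ++ framed (vals s).
Proof.
rewrite /SB_words /framed_pairs /framed size_map -map_comp (size_map _ s) /=.
congr (_ :: flatten _ ++ _).
by apply: eq_map => p; rewrite /list_words /framed /= !size_map.
Qed.

Lemma size_framed_sides B :
  size (framed_pairs (sides B)) = weight B + 2 * size B.
Proof.
rewrite /weight; elim: B => [|p B IH]; first by rewrite big_nil.
have sz l : size (framed l) = (size l).+1 by [].
rewrite big_cons framed_pairs_cons !size_cat IH !sz !size_vals.
by move: (\sum_(_ <- B) _) => W; rewrite /=; lia.
Qed.

Lemma meets_vals A S s :
  perm_eq s (enum S) -> meets (vals s) (vals (enum A)) = (A :&: S != set0).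
Proof.
move=> /perm_mem sS; apply/hasP/set0Pn => [[_ /mapP[v vA ->]] | [v]].
  rewrite /= mem_map; last exact: val_inj.
  by rewrite sS mem_enum => vS; exists v; rewrite inE -mem_enum vA.
case/setIP => vA vS; exists (val v); first by rewrite map_f ?mem_enum.
by rewrite /= map_f // sS mem_enum.
Qed.

End Words.

(** With [N = 2 ^ bits n > n] and [N >= 2], the left side is less than
    [8 * (n + 1) ^ 3 <= N ^ 3 * N ^ 3]. *)
Lemma input_fits n w :
  6 * bits n <= w -> 2 * n * (n * n) + 2 * (n * n) + 2 * n + 3 < 2 ^ w.
Proof.
move=> le_w; apply: leq_trans (leq_pexp2l (isT : 0 < 2) le_w).
rewrite [6 * _]mulnC expnM.
have : n < 2 ^ bits n by exact: trunc_log_ltn.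
have : 1 < 2 ^ bits n by rewrite -[1]/(2 ^ 0) ltn_exp2l.
move: (2 ^ bits n) => N N1 nN.
have N3 : 8 <= N ^ 3 by rewrite -[8]/(2 ^ 3) leq_exp2r.
have n3 : n.+1 ^ 3 <= N ^ 3 by rewrite leq_exp2r.
rewrite -[6]/(3 + 3) expnD; apply: (@leq_trans (8 * n.+1 ^ 3)).
  by rewrite !expnS expn0 muln1; nia.
exact: leq_mul.
Qed.

Theorem mainTheorem11 :
  exists (P : program) (a : nat), 0 < a /\
  forall b : nat, exists c : nat,
  forall (n w : nat), a * bits n <= w <= b * bits n ->
  forall (e : rel 'I_n), symmetric e -> irreflexive e ->
  forall (B : seq ({set 'I_n} * {set 'I_n})), biclique_partition e B ->
  forall (S : {set 'I_n}) (s : seq 'I_n), perm_eq s (enum S) ->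
  forall (m : nat -> nat), holds_input w (SB_words B ++ list_words s) m ->
  answers_within w P m (c * (weight B + #|S| + 1)) (independent e S).
Proof.
(* The run takes at most 7 steps per element of [S], 14 per unit of weight,
   10 + 2 * 14 per biclique and 18 more. A biclique weighs at least 1, whence
   the constant 14 + 38 = 52. *)
exists prog, 6; split=> // b; exists 52 => n w /andP[le_w _] e _ _ B partB.
move=> S s sS m [_ m_in].
have w_gt0 : 0 < w by apply: leq_trans le_w.
have szS : size s = #|S| by rewrite (perm_size sS) -cardE.
have leS : #|S| <= n by rewrite -[n in _ <= n]card_ord max_card.
have fits := input_fits le_w.
have leB := size_biclique_partition partB.
have leBw := size_leq_weight partB.
have lew := weight_leq B.
have lew' : weight B <= 2 * n * (n * n).
  by apply: leq_trans lew _; rewrite leq_mul2l leB orbT.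
rewrite input_words in m_in.
have := @prog_correct w w_gt0 m _ _ n m_in (all_sides B) (all_vals s).
rewrite size_framed_sides !size_map szS => run.
have [||t le_t [halt_t ans_t]] := run; try lia.
exists t; first by lia.
split=> //; rewrite ans_t (independent_bicliques partB) has_map.
by congr (_ (~~ _)); apply: eq_has => p /=; rewrite !(meets_vals _ sS).
Qed.
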